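(* Let $n\ge 1$, let $K>1$ be an integer, and fix an initial state $\mathfrak{X}(0)$ and a terminal state $\mathfrak{X}_T$ of the moment system (defined in the context). Then the set $$\mathcal{U}_{\mathfrak{X}_T}=\Big\{(\mathfrak{U}(0),\dots,\mathfrak{U}(K-1))\in(\mathbb{R}^{2n})^K \;:\; \mathfrak{X}(k+1)=\mathfrak{A}_k(\mathfrak{U}(k))\,\mathfrak{X}(k)+\mathfrak{U}(k)\ \text{for } k=0,\dots,K-1,\ \ \mathfrak{X}(K)=\mathfrak{X}_T\Big\}$$ (where the trajectory $\mathfrak{X}(1),\dots,\mathfrak{X}(K)$ is generated from the fixed $\mathfrak{X}(0)$) is not convex.
   Context: The underlying scalar system is $x(k+1)=a(k)x(k)+u(k)$ with $a(k)\in(0,1)$ for all $k$. Moment system: the state $\mathfrak{X}(k)=(\mathfrak{X}_1(k),\dots,\mathfrak{X}_{2n}(k))^T\in\mathbb{R}^{2n}$ represents the power moments $\mathbb{E}[x^l(k)]$, $l=1,\dots,2n$, and the control $\mathfrak{U}(k)=(\mathfrak{U}_1(k),\dots,\mathfrak{U}_{2n}(k))^T\in\mathbb{R}^{2n}$ represents the power moments $\mathbb{E}[u^l(k)]$, $l=1,\dots,2n$, where $x(k)$ and $u(k)$ are independent. For $\mathfrak{U}\in\mathbb{R}^{2n}$, with the convention $\mathfrak{U}_0=1$, the matrix $\mathfrak{A}_k(\mathfrak{U})\in\mathbb{R}^{2n\times 2n}$ is lower triangular with entries $(\mathfrak{A}_k(\mathfrak{U}))_{l,j}=\binom{l}{j}a(k)^j\,\mathfrak{U}_{l-j}$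 for $1\le j\le l\le 2n$ and $0$ for $j>l$. Equivalently, with $\mathfrak{X}_0(k)=1$, $\mathfrak{X}_l(k+1)=\sum_{j=0}^{l}\binom{l}{j}a(k)^j\mathfrak{X}_j(k)\mathfrak{U}_{l-j}(k)$. The initial and terminal states $\mathfrak{X}(0)$ and $\mathfrak{X}_T$ are moment vectors with positive definite Hankel matrices, i.e. for $\mathfrak{X}\in\{\mathfrak{X}(0),\mathfrak{X}_T\}$ the $(n+1)\times(n+1)$ matrix with $(i,j)$ entry $\mathfrak{X}_{i+j}$, $0\le i,j\le n$ (with $\mathfrak{X}_0=1$), is positive definite. *)

(* Defs.v *)
From mathcomp Require Import all_boot all_order all_algebra.
From mathcomp Require Import all_classical all_reals all_analysis.

Set Implicit Arguments.
Unset Strict Implicit.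
Unset Printing Implicit Defensive.

Import Order.TTheory GRing.Theory Num.Theory.

Local Open Scope classical_set_scope.
Local Open Scope ring_scope.

(* A vector v : 'cV[R]_m stores the power moments of orders 1, ..., m, the
   moment of order l sitting in row l - 1.  [moment v l] is the moment of
   order l, with the convention that the moment of order 0 is 1; orders
   l > m get the junk value 0. *)
Definition moment (R : realType) (m : nat) (v : 'cV[R]_m) (l : nat) : R :=
  if l is l'.+1 then oapp (fun i : 'I_m => v i 0) 0 (insub l') else 1.

Definition hankel_mx (R : realType) (n : nat) (v : 'cV[R]_(2 * n)) :
    'M[R]_n.+1 :=
  \matrix_(i, j) moment v (i + j).

Definition posdef_mx (R : realType) (m : nat) (M : 'M[R]_m) : Prop :=
  M^T = M /\ forall v : 'cV[R]_m, v != 0 -> 0 < (v^T *m M *m v) 0 0.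

(* Rows and columns are numbered from 0, so the entry (i, j) is the entry
   (l, j') = (i + 1, j + 1) of the usual 1-based description. *)
Definition system_mx (R : realType) (n : nat) (a : R) (U : 'cV[R]_(2 * n)) :
    'M[R]_(2 * n) :=
  \matrix_(i, j) if (j <= i)%N
                 then 'C(i.+1, j.+1)%:R * a ^+ j.+1 * moment U (i.+1 - j.+1)
                 else 0.

(* Only the values X 0, ..., X K of the trajectory X are constrained. *)
Definition control_set (R : realType) (n K : nat) (a : nat -> R)
    (X0 XT : 'cV[R]_(2 * n)) : set {ffun 'I_K -> 'cV[R]_(2 * n)} :=
  [set U | exists X : nat -> 'cV[R]_(2 * n),
     [/\ X 0%N = X0,
         forall k : 'I_K, X k.+1 = system_mx (a k) (U k) *m X k + U k
       & X K = XT]].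

(* Main.v *)
Require Import Defs.
From mathcomp Require Import all_boot all_order all_algebra.
From mathcomp Require Import all_classical all_reals all_analysis.
From mathcomp Require Import ring lra.

(** Composing two steps of the system multiplies the unknowns: the second moment
of the terminal state contains the product of the means of the last two controls.
Let Z be the state reached before these two steps, with scalars a and b, and let
p be its mean.  If u and v are the means of the last two controls, then fixing
the terminal mean fixes the sum b (a p + u) + v, whereas the terminal second
moment is affine in the moments of the two controls except for the term 2 b u v.
On the line where v = const - b u this term is a strictly concave function of u,
so the midpoint of two admissible pairs with distinct u overshoots the
prescribed second moment ([two_steps_midpoint_neq]).

It remains to exhibit two admissible control sequences that share everything
before the last two steps and differ in the mean u.  The last control can always
be chosen to repair whatever came before it: the moment of order l of the next
state is the moment of order l of the control plus an expression in its moments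
of lower orders, and such a system is solved order by order ([step_surj]).  Hence
taking zero controls first and any value of u next still allows the terminal
state to be reached ([control_with_mean]). *)

Set Implicit Arguments.
Unset Strict Implicit.
Unset Printing Implicit Defensive.

Import Order.TTheory GRing.Theory Num.Theory.
Local Open Scope ring_scope.

(** * Moment vectors *)

Section Moments.

Variables (R : realType) (m : nat).
Implicit Types u v : 'cV[R]_m.

Lemma moment_ord v (i : 'I_m) : moment v i.+1 = v i 0.
Proof. by rewrite /moment valK. Qed.

(** Order 0 is excluded because the convention that this moment is 1 is affine,
not linear. *)
Lemma moment_lin (c d : R) u v l : (0 < l)%N ->
  moment (c *: u + d *: v) l = c * moment u l + d * moment v l.
Proof.
case: l => // l _; rewrite /moment.
by case: insubP => [i _ _|_] /=; rewrite ?mxE ?mulr0 ?addr0.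
Qed.

Lemma eq_moment u v l :
  (forall i : 'I_m, (i < l)%N -> u i 0 = v i 0) -> moment u l = moment v l.
Proof.
case: l => // l uv; rewrite /moment.
by case: insubP => //= i _ il; apply: uv; rewrite il.
Qed.

(** A strictly causal perturbation of the identity, whose row i reads only the
rows before i, is onto: the rows of a preimage are found one after the other,
each being the row of [y] minus what the earlier rows already contribute. *)
Lemma causal_shift_surj (F : 'cV[R]_m -> 'cV[R]_m) :
    (forall (i : 'I_m) u v,
       (forall j : 'I_m, (j < i)%N -> u j 0 = v j 0) -> F u i 0 = F v i 0) ->
  forall y, exists u, F u + u = y.
Proof.
move=> Fcausal y.
have rows l : exists u, forall i : 'I_m, (i < l)%N -> (F u + u) i 0 = y i 0;
  last by have [u uP] := rows m; exists u; apply/colP => i; apply: uP.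
elim: l => [|l [u uP]]; first by exists 0.
exists (\col_i if i == l :> nat then y i 0 - F u i 0 else u i 0) => i.
have FE (v := \col_i if i == l :> nat then y i 0 - F u i 0 else u i 0) :
    (i <= l)%N -> F v i 0 = F u i 0.
  move=> il; apply: Fcausal => j ji.
  by rewrite mxE ltn_eqF// (leq_trans ji).
rewrite ltnS => il; rewrite mxE FE// mxE; case: eqP => [_|/eqP nil].
  by rewrite addrC subrK.
by rewrite -uP 1?ltn_neqAle ?nil// mxE.
Qed.

End Moments.

(** * One and two steps of the system *)

Section Step.

Variables (R : realType) (n : nat).
Implicit Types (a : R) (U V X : 'cV[R]_(2 * n)).

Definition step a U X : 'cV[R]_(2 * n) := system_mx a U *m X + U.

(** The sum is the binomial expansion of the moment of a x + u for independent x
and u.  Its term of index 0 is the added control, and the others are the entries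
of the row of [system_mx]. *)
Lemma moment_step a U X l : (l <= 2 * n)%N ->
  moment (step a U X) l =
  \sum_(j < l.+1) 'C(l, j)%:R * a ^+ j * moment X j * moment U (l - j).
Proof.
case: l => [_|l lm]; first by rewrite big_ord1 /= !mulr1.
have -> : l.+1 = (Ordinal lm).+1 by [].
rewrite moment_ord big_ord_recl /= bin0 expr0 !mulr1 mul1r !mxE.
rewrite -(moment_ord U) addrC; congr (_ + _).
rewrite (big_ord_widen _ (fun j => 'C(l.+1, j.+1)%:R * a ^+ j.+1
  * moment X j.+1 * moment U (l.+1 - j.+1)) lm) [RHS]big_mkcond.
apply: eq_bigr => j _; rewrite mxE /= ltnS -moment_ord.
by case: ifP => _; rewrite ?mul0r// mulrAC.
Qed.

Lemma moment_step1 a U X : (0 < n)%N ->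
  moment (step a U X) 1 = a * moment X 1 + moment U 1.
Proof.
move=> n0; rewrite moment_step; last by rewrite muln_gt0.
by rewrite 2!big_ord_recl big_ord0 /bump /= !addn0 bin0 bin1; ring.
Qed.

Lemma moment_step2 a U X : (0 < n)%N ->
  moment (step a U X) 2 =
  a ^+ 2 * moment X 2 + 2 * a * moment X 1 * moment U 1 + moment U 2.
Proof.
move=> n0; rewrite moment_step; last by rewrite leq_pmulr.
by rewrite 3!big_ord_recl big_ord0 /bump /= !addn0 bin0 bin1 binn; ring.
Qed.

(** Row i of [system_mx a U] involves only moments of [U] of order at most i,
which are stored in the rows before i; so the step is a strictly causal
perturbation of the identity in [U]. *)
Lemma step_surj a X Y : exists U, step a U X = Y.
Proof.
apply: (causal_shift_surj (F := fun U => system_mx a U *m X)) => i U V UV.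
rewrite !mxE; apply: eq_bigr => j _; rewrite !mxE; case: ifP => // _.
congr (_ * _ * _); apply: eq_moment => h hij; apply: UV.
by rewrite (leq_trans hij)// subSS leq_subr.
Qed.

(** Equality of the terminal means forces the means of
the second controls to differ by - b (u0 - v0).  The mean of the two terminal
second moments then falls short of the one reached from the midpoint by
(b (u0 - v0))^2 / 2, by the polarization of the product of means. *)
Lemma two_steps_midpoint_neq a (b : R) Z T U0 V0 U1 V1 : (0 < n)%N -> b != 0 ->
    step b U1 (step a U0 Z) = T -> step b V1 (step a V0 Z) = T ->
    moment U0 1 != moment V0 1 ->
  step b (2^-1 *: U1 + 2^-1 *: V1) (step a (2^-1 *: U0 + 2^-1 *: V0) Z) <> T.
Proof.
move=> n0 b0 TU TV UV TW; move: UV; apply/negP; rewrite negbK -subr_eq0.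
have E1 := congr1 (fun v => moment v 1) (etrans TU (esym TV)).
have E2 := congr1 (fun v => moment v 2) (etrans TU (esym TV)).
have E3 := congr1 (fun v => moment v 2) (etrans TW (esym TU)).
move: E1 E2 E3; cbv beta.
rewrite !moment_step2// !moment_step1// !moment_lin//.
move: (moment U0 1) (moment U0 2) (moment V0 1) (moment V0 2) => u0 u0' v0 v0'.
move: (moment U1 1) (moment U1 2) (moment V1 1) (moment V1 2) => u1 u1' v1 v1'.
move: (moment Z 1) (moment Z 2) => z z' E1 E2 E3.
(* E1 is the equality of terminal means; combined with E2, which equates the
   terminal second moments, it turns E3 into the vanishing of a square. *)
have Ev : v1 = b * (u0 - v0) + u1 by lra.
have : b ^+ 2 * (u0 - v0) ^+ 2 = 0 by rewrite Ev in E2 E3; lra.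
by move=> /eqP; rewrite mulf_eq0 !expf_eq0 /= (negbTE b0).
Qed.

End Step.

(** * Controls acting in the last two steps *)

Section Controls.

Variables (R : realType) (n k : nat) (a : nat -> R) (X0 XT : 'cV[R]_(2 * n)).

Let k0 : 'I_k.+2 := inord k.
Let k1 : 'I_k.+2 := inord k.+1.

(** When the earlier controls vanish, the state before the last two steps is the
free evolution of [X0], hence common to all such control sequences. *)
Lemma last_two_steps (U : {ffun 'I_k.+2 -> 'cV[R]_(2 * n)}) :
    control_set a X0 XT U -> (forall i : 'I_k.+2, (i < k)%N -> U i = 0) ->
  step (a k.+1) (U k1) (step (a k) (U k0)
    (iteri k (fun i => step (a i) 0) X0)) = XT.
Proof.
move=> [X [X0E XS XTE]] U0.
have k0E : k0 = k :> nat by rewrite inordK.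
have k1E : k1 = k.+1 :> nat by rewrite inordK.
have XE i : (i <= k)%N -> X i = iteri i (fun i => step (a i) 0) X0.
  elim: i => //= i IH ik.
  have iK : (i < k.+2)%N by rewrite ltnS ltnW// ltnW.
  have := XS (Ordinal iK); rewrite /= => ->.
  by rewrite U0// -IH// ltnW.
rewrite -XE// -XTE; have := XS k1; have := XS k0.
by rewrite k0E k1E => -> ->.
Qed.

(** The mean of the last but one control is free, because the last control can
send the state it produces to [XT]. *)
Lemma control_with_mean (s : R) : (0 < n)%N ->
  exists U : {ffun 'I_k.+2 -> 'cV[R]_(2 * n)},
    [/\ control_set a X0 XT U, forall i : 'I_k.+2, (i < k)%N -> U i = 0
      & moment (U k0) 1 = s].
Proof.
move=> n0; pose Z i := iteri i (fun i => step (a i) 0) X0.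
pose Y := step (a k) (const_mx s) (Z k).
have [V VT] := step_surj (a k.+1) Y XT.
pose u i : 'cV[R]_(2 * n) :=
  if (i < k)%N then 0 else if i == k then const_mx s else V.
exists [ffun i : 'I_k.+2 => u i]; split.
- exists (fun i => if (i <= k)%N then Z i else if i == k.+1 then Y else XT).
  split=> //=; last by rewrite ltnNge leqnSn/= eqn_leq ltnn.
  move=> i; rewrite ffunE /u; case: (ltngtP i k) => [ik|ki|->] //.
    have -> : i = k.+1 :> nat.
      by apply/eqP; rewrite eqn_leq ki andbT -ltnS ltn_ord.
    by rewrite eqn_leq ltnn /= eqxx.
  by rewrite eqxx.
- by move=> i ik; rewrite ffunE /u ik.
- rewrite ffunE /u inordK// ltnn eqxx.
  have n2 : (0 < 2 * n)%N by rewrite muln_gt0.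
  by rewrite (moment_ord _ (Ordinal n2)) mxE.
Qed.

End Controls.

Theorem lemma3p1 (R : realType) (n K : nat) (a : nat -> R)
    (X0 XT : 'cV[R]_(2 * n))
    (n_ge1 : (1 <= n)%N) (K_gt1 : (1 < K)%N)
    (a_01 : forall k, 0 < a k < 1)
    (X0_posdef : posdef_mx (hankel_mx X0))
    (XT_posdef : posdef_mx (hankel_mx XT)) :
  ~ convex_set (control_set (K := K) a X0 XT).
Proof.
case: K K_gt1 => [|[|k]] // _ cvx.
have [U [UT U0 U1]] := control_with_mean k a X0 XT 0 n_ge1.
have [V [VT V0 V1]] := control_with_mean k a X0 XT 1 n_ge1.
pose W : {ffun 'I_k.+2 -> 'cV[R]_(2 * n)} := 2^-1 *: U + 2^-1 *: V.
have WT : control_set a X0 XT W.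
  have -> : W = 2^-1 *: U + (1 - 2^-1) *: V.
    by rewrite /W; congr (_ + _ *: _); lra.
  have half0 : 0 <= 2^-1 :> R by lra.
  have half1 : 2^-1 <= 1 :> R by lra.
  exact: set_mem (cvx U V (Itv01 half0 half1) (mem_set UT) (mem_set VT)).
have WE i : W i = 2^-1 *: U i + 2^-1 *: V i by rewrite !ffunE.
have W0 (i : 'I_k.+2) : (i < k)%N -> W i = 0.
  by move=> ik; rewrite WE U0// V0// !scaler0 addr0.
have := last_two_steps WT W0; rewrite !WE.
apply: two_steps_midpoint_neq => //.
- by have /andP[/lt0r_neq0] := a_01 k.+1.
- exact: last_two_steps.
- exact: last_two_steps.
- by rewrite U1 V1 eq_sym oner_eq0.
Qed.
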